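(* Let $n\in\mathbb N$ with $n\ge 2$, and let $\Lambda_n,\Xi_n$ be the even polynomials defined in the context. All zeros of $\Lambda_n(x)$ and $\Xi_n(x)$ lie in $(-1,1)\setminus\{0\}$. Moreover, they are real and simple, and the zeros of $\Lambda_n(x)$ interlace those of $\Lambda_{n+1}(x)$, while the zeros of $\Xi_n(x)$ interlace those of $\Xi_{n+1}(x)$.
   Context: $\mathbb N=\{1,2,3,\dots\}$. Binomial coefficients satisfy $\binom{m}{\ell}=0$ whenever $\ell<0$ or $\ell>m$. The Eulerian number of type $A$, $\left\langle{m\atop k}\right\rangle$ ($m\ge1$, $0\le k\le m-1$), is the number of permutations of $\{1,\dots,m\}$ with exactly $k$ descents; equivalently $\sum_{j\ge0}(j+1)^m x^j=(1-x)^{-m-1}\sum_{k=0}^{m-1}\left\langle{m\atop k}\right\rangle x^k$ for $|x|<1$. The Eulerian number of type $B$, $\left\langle{m\atop k}\right\rangle^{B}$ ($m\ge0$, $0\le k\le m$), is determined by $\sum_{j\ge0}(2j+1)^m x^j=(1-x)^{-m-1}\sum_{k=0}^{m}\left\langle{m\atop k}\right\rangle^{B} x^k$ for $|x|<1$. For $n\in\mathbb N$ and $0\le t\le n-1$ let $$\mathcal C^{(B)}_{n,t}:=\sum_{k=0}^{n-1}\left\langle {2n-1 \atop k}\right\rangle^{B}(-1)^{k}\sum_{i=0}^{k}(-1)^i\binom{k}{i}\binom{2n-2k-1}{2t-2i+1},\quad \mathcal C^{(A)}_{n,t}:=\sum_{k=0}^{n-1}\left\langle {2n \atop k}\right\rangle(-1)^{k}\sum_{i=0}^{k}(-1)^i\binom{k}{i}\binom{2n-2k-1}{2t-2i+1},$$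 $$\Xi_n(x):=\frac{(-1)^{n+1}}{2^{4n-2}(2n-1)!}\sum_{t=0}^{n-1}\mathcal C^{(B)}_{n,t}\,x^{2t},\qquad \Lambda_n(x):=\frac{2(-1)^{n+1}}{(2^{2n+1}-1)(2n)!}\sum_{t=0}^{n-1}\mathcal C^{(A)}_{n,t}\,x^{2t}.$$ *)

(* Defs.v *)
From mathcomp Require Import all_boot all_order all_algebra all_fingroup.
From mathcomp Require Import complex.
From mathcomp Require Import all_classical all_reals all_analysis.

Set Implicit Arguments.
Unset Strict Implicit.
Unset Printing Implicit Defensive.

Import Order.TTheory GRing.Theory Num.Theory.
Import numFieldNormedType.Exports.

Local Open Scope classical_set_scope.
Local Open Scope ring_scope.

(* 'C(m, l) for an integer lower index; 0 when l < 0 or l > m *)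
Definition binz (m : nat) (l : int) : nat :=
  if l is Posz j then 'C(m, j) else 0%N.

(* A descent of s is recorded as the pair of adjacent positions (i, i + 1). *)
Definition descents (m : nat) (s : 'S_m) : nat :=
  #|[pred p : 'I_m * 'I_m | (p.2 == p.1.+1 :> nat) && (s p.2 < s p.1)%N]|.

Definition eulerianA (m k : nat) : nat :=
  #|[pred s : 'S_m | descents s == k]|.

(* p(x) = sum_(k <= m) <m, k>^B x^k *)
Definition is_eulerianB_poly (R : realType) (m : nat) (p : {poly R}) : Prop :=
  (size p <= m.+1)%N /\
  forall x : R, `|x| < 1 ->
    series (fun j : nat => (2 * j + 1)%:R ^+ m * x ^+ j) @ \oo
      --> p.[x] / (1 - x) ^+ m.+1.

(* The polynomial is unique, as its values on ]-1, 1[ are prescribed. *)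
Definition eulerianB_poly (R : realType) (m : nat) : {poly R} :=
  xget 0 [set p | is_eulerianB_poly m p].

Definition eulerianB (R : realType) (m k : nat) : R := (eulerianB_poly R m)`_k.

(* The double sum common to both types; E k is the Eulerian number with
   lower index k. *)
Definition eulerian_coef (R : realType) (E : nat -> R) (n t : nat) : R :=
  \sum_(k < n) E k * (-1) ^+ k *
    \sum_(i < k.+1) (-1) ^+ i * 'C(k, i)%:R *
      (binz (2 * n - 2 * k - 1) ((2 * t)%:Z - (2 * i)%:Z + 1))%:R.

Definition eulerian_coefB (R : realType) (n t : nat) : R :=
  eulerian_coef (eulerianB R (2 * n - 1)) n t.

Definition eulerian_coefA (R : realType) (n t : nat) : R :=
  eulerian_coef (fun k => (eulerianA (2 * n) k)%:R) n t.

Definition Xi (R : realType) (n : nat) : {poly R} :=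
  ((-1) ^+ n.+1 / (2 ^+ (4 * n - 2) * (2 * n - 1)`!%:R)) *:
    \sum_(t < n) eulerian_coefB R n t *: 'X^(2 * t).

Definition Lambda (R : realType) (n : nat) : {poly R} :=
  (2 * (-1) ^+ n.+1 / ((2 ^+ (2 * n + 1) - 1) * (2 * n)`!%:R)) *:
    \sum_(t < n) eulerian_coefA R n t *: 'X^(2 * t).

(* Every complex zero of p is real, simple and in ]-1, 1[ \ {0}; in particular
   p is not the zero polynomial. *)
Definition zeros_real_simple (R : realType) (p : {poly R}) : Prop :=
  let pC := map_poly (real_complex R) p in
  forall z : R[i], root pC z ->
    mup z pC = 1%N /\
    exists x : R, [/\ z = real_complex R x, -1 < x < 1 & x != 0].

(* Interlacing for even polynomials p, q without zero at the origin and with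
   deg q = deg p + 2: p has zeros +-a_i and q has zeros +-b_i, where
     0 < b_0 < a_0 < b_1 < a_1 < ... < a_(r-1) < b_r.
   The zeros cannot alternate on the whole line, as none of the +-a_i lies
   between -b_0 and b_0; they alternate on each half-line. *)
Definition zeros_interlace (R : realType) (p q : {poly R}) : Prop :=
  exists a b : seq R,
    [/\ forall x, root p x = (`|x| \in a),
        forall x, root q x = (`|x| \in b),
        size b = (size a).+1,
        0 < b`_0
      & forall i, (i < size a)%N -> b`_i < a`_i < b`_i.+1].

(* Main.v *)
Require Import Defs.
From mathcomp Require Import all_boot all_order all_algebra.
From mathcomp Require Import all_classical all_reals all_analysis.
From mathcomp Require Import all_fingroup complex ring lra zify.

Set Implicit Arguments.
Unset Strict Implicit.
Unset Printing Implicit Defensive.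

Import Order.TTheory GRing.Theory Num.Theory.
Import numFieldNormedType.Exports.
Local Open Scope classical_set_scope.
Local Open Scope ring_scope.

(** Let [f_m] be the polynomial with
      D^m (sech z)^c = (-1)^m f_m(tanh z) (sech z)^c,
    so that f_0 = 1 and f_(m+1) = (x^2 - 1) f_m' + c x f_m.

    Expanding the inner sums of the statement and multiplying by x, the k-th
    summand is the Eulerian number of index k times the odd part of
    (x - 1)^k (x + 1)^(2n - 1 - k); by the symmetry of the Eulerian numbers
    the sum over k < n is half of the full sum over k < 2n, which is the
    Eulerian polynomial at (x - 1) / (x + 1), homogenized.  The Eulerian
    recurrences turn into the recurrence of [f_m]: type B corresponds to c = 1
    and type A to c = 2.  Hence x Xi_n and x Lambda_n are nonzero multiples of
    f_(2n-1) ([homogenized_eulerianE], [eulerian_coefE], [XiE], [LambdaE]).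
    The recurrences themselves come from the insertion of the largest value in
    a permutation for type A ([eulerianA_rec]) and from differentiating the
    partial sums of the power series for type B ([power_sum_remainder]).

    Write f_m = x^(m mod 2) p_m(x^2), where [p_m] is [sech_poly c m].  If [p_m]
    has simple zeros in ]0, 1[, then p_(m+1) / p_m is an affine function minus a
    sum of simple fractions with positive weights, a function that maps the
    upper half-plane to itself; so p_(m+1) has only simple real zeros
    ([real_rooted_partial_fractions]), and a look at the signs puts them in
    ]0, 1[ ([sech_poly_split]).  A zero a of [p_m] gives the zeros +-sqrt a of
    the even polynomial.

    Consecutive f_m interlace for this reason, but the theorem compares [f_m]
    with f_(m+2).  Differentiating (sech z)^c twice gives
      f_(m+2)[c] = c^2 f_m[c] - c (c + 1) (1 - x^2) f_m[c + 2],
    so at a zero of f_m[c] the sign of f_(m+2)[c] is opposite to the sign of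
    f_m[c + 2].  The latter is known because the positive zeros decrease when c
    grows: p_m[c + 2] has the sign of the derivative of p_m[c] at every zero of
    p_m[c], a property that propagates along the recurrence
    ([sech_poly_shift_sign]).  The signs of p_(m+2) at the zeros of [p_m] and
    the numbers of zeros then force the interlacing, by counting the zeros of
    p_(m+2) above each zero of [p_m] ([interlace_of_signs]). *)

(** * Partial fractions, Bezoutians and real-rootedness *)

Local Notation root_prod s := (\prod_(a <- s) ('X - a%:P)).

Section Bezoutian.
Variables (K : idomainType) (s : seq K).

Lemma root_prod_rem (x : K) : x \in s ->
  root_prod s = ('X - x%:P) * root_prod (rem x s).
Proof. by move=> xs; rewrite (big_rem x xs). Qed.

Lemma horner_root_prod_rem (x z : K) : x \in s ->
  (root_prod s).[z] = (z - x) * (root_prod (rem x s)).[z].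
Proof. by move/root_prod_rem->; rewrite hornerM hornerXsubC. Qed.

(** Writing P_x = P / (X - x), the terms of the sum satisfy
    P_x(z) P(y) - P_x(y) P(z) = (y - z) P_x(y) P_x(z), because
    P(y) = (y - x) P_x(y).  Used at a pair of conjugate points, this is the
    polynomial form of the fact that Q / P preserves the upper half-plane. *)
Lemma bezoutian_partial_fractions (a b : K) (p : K -> K) (y z : K) :
  let P := root_prod s in
  let Q := (a *: 'X + b%:P) * P - \sum_(x <- s) p x *: root_prod (rem x s) in
  Q.[y] * P.[z] - Q.[z] * P.[y] =
    (y - z) * (a * (P.[y] * P.[z]) +
      \sum_(x <- s) p x * ((root_prod (rem x s)).[y] * (root_prod (rem x s)).[z])).
Proof.
move=> P Q; rewrite /Q !(hornerD, hornerN, hornerM, hornerZ, hornerX, hornerC, horner_sum).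
rewrite mulrDr mulr_sumr.
have -> : \sum_(x <- s) (y - z) *
    (p x * ((root_prod (rem x s)).[y] * (root_prod (rem x s)).[z]))
  = \sum_(x <- s) (p x *: root_prod (rem x s)).[z] * P.[y]
    - \sum_(x <- s) (p x *: root_prod (rem x s)).[y] * P.[z].
  rewrite -sumrB; apply: eq_big_seq => x xs.
  rewrite /P !(horner_root_prod_rem _ xs) !hornerZ; ring.
rewrite -!mulr_suml; ring.
Qed.

(** The limit of the previous identity when the two points merge: it makes
    Q / P increasing between its poles. *)
Lemma wronskian_partial_fractions (a b : K) (p : K -> K) :
  let P := root_prod s in
  let Q := (a *: 'X + b%:P) * P - \sum_(x <- s) p x *: root_prod (rem x s) in
  Q^`() * P - Q * P^`() =
    a *: P ^+ 2 + \sum_(x <- s) p x *: root_prod (rem x s) ^+ 2.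
Proof.
move=> P Q; rewrite /Q derivB derivM derivD derivZ derivX derivC addr0 raddf_sum.
have -> : \sum_(x <- s) p x *: root_prod (rem x s) ^+ 2
  = \sum_(x <- s) p x *: root_prod (rem x s) * P^`()
    - \sum_(x <- s) (p x *: root_prod (rem x s))^`() * P.
  rewrite -sumrB; apply: eq_big_seq => x xs.
  rewrite /P (root_prod_rem xs) derivM derivXsubC derivZ -!mul_polyC; ring.
rewrite -!mulr_suml -!mul_polyC; ring.
Qed.

End Bezoutian.

Lemma root_prod_eval0 (K : idomainType) (s : seq K) (x : K) : x \in s ->
  (root_prod s).[x] = 0.
Proof. by move=> xs; apply/eqP; rewrite -/(root _ _) root_prod_XsubC. Qed.

Lemma deriv_root_prod (K : idomainType) (s : seq K) :
  (root_prod s)^`() = \sum_(x <- s) root_prod (rem x s).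
Proof.
elim: s => [|a s IH]; first by rewrite !big_nil derivC.
rewrite !big_cons derivM derivXsubC mul1r IH /= eqxx; congr (_ + _).
rewrite mulr_sumr; apply: eq_big_seq => x xs.
case: eqP => [ax|_]; last by rewrite big_cons.
by rewrite ax [RHS](root_prod_rem xs).
Qed.

(** A repeated root would be a root of the derivative. *)
Lemma uniq_of_deriv_neq0 (K : idomainType) (s : seq K) :
  {in s, forall x, (root_prod s)^`().[x] != 0} -> uniq s.
Proof.
move=> h; apply: count_mem_uniq => x.
have [xs|/count_memPn->//] := boolP (x \in s).
have := h x xs; rewrite (root_prod_rem xs) derivM derivXsubC hornerD !hornerM.
rewrite hornerXsubC subrr mul0r addr0 hornerC mul1r -/(root _ _) root_prod_XsubC.
move/count_memPn; rewrite count_rem xs /= eqxx => /eqP; rewrite subn_eq0 => le1.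
by apply/eqP; rewrite eqn_leq le1 -has_count has_pred1.
Qed.

Lemma horner_root_prod_rem_neq0 (K : idomainType) (s : seq K) (x z : K) :
  uniq s -> x \in s -> z \notin s \/ z = x -> (root_prod (rem x s)).[z] != 0.
Proof.
move=> us xs h; rewrite -/(root _ _) root_prod_XsubC mem_rem_uniq // !inE.
by case: h => [/negPf->|->]; rewrite ?andbF ?eqxx.
Qed.

(** The terms are nonnegative and they do not vanish together: outside [s] no
    factor is zero, and at a point z of [s] the term of index z survives, as [s]
    has no repetition. *)
Lemma bezoutian_diag_gt0 (K : numFieldType) (s : seq K) (a : K) (p : K -> K) (z : K) :
  uniq s -> 0 <= a -> {in s, forall x, 0 < p x} -> (0 < a) || (s != [::]) ->
  0 < a * `|(root_prod s).[z]| ^+ 2 +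
      \sum_(x <- s) p x * `|(root_prod (rem x s)).[z]| ^+ 2.
Proof.
move=> us a0 p0 nz.
have t0 r : (forall x, x \in r -> x \in s) ->
    0 <= \sum_(x <- r) p x * `|(root_prod (rem x s)).[z]| ^+ 2.
  move=> rs; rewrite big_seq; apply: sumr_ge0 => x /rs xs.
  by rewrite mulr_ge0 ?exprn_ge0 // ltW // p0.
have key x : x \in s -> z \notin s \/ z = x ->
    0 < \sum_(x <- s) p x * `|(root_prod (rem x s)).[z]| ^+ 2.
  move=> xs h; rewrite (big_rem x xs) /= ltr_pwDl ?t0 //; last by move=> y /mem_rem.
  by rewrite mulr_gt0 ?p0 // exprn_gt0 // normr_gt0 horner_root_prod_rem_neq0.
have [zs|zs] := boolP (z \in s).
  by rewrite ltr_wpDl ?(key z) //; [rewrite mulr_ge0 ?exprn_ge0|right].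
case/orP: nz => [a_gt0|].
  rewrite ltr_pwDl ?t0 // mulr_gt0 // exprn_gt0 // normr_gt0.
  by rewrite -/(root _ _) root_prod_XsubC.
case: s us p0 t0 key zs => [//|x r] us p0 t0 key zs _.
by rewrite ltr_wpDl ?(key x) ?mem_head //; [rewrite mulr_ge0 ?exprn_ge0|left].
Qed.

(** If z is a complex root of Q, so is its conjugate; the Bezoutian at these two
    points is (z - conj z) times a positive number, so z is real.  At a real root
    the Wronskian reduces to P Q', whence the sign and the simplicity.  When
    a = 0 and [s] is empty, Q is a constant. *)
Lemma real_rooted_partial_fractions (R : rcfType) (s : seq R) (a b : R) (p : R -> R) :
  uniq s -> 0 <= a -> {in s, forall x, 0 < p x} ->
  let P := root_prod s in
  let Q := (a *: 'X + b%:P) * P - \sum_(x <- s) p x *: root_prod (rem x s) in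
  Q != 0 ->
  exists t : seq R, [/\ uniq t, Q = lead_coef Q *: root_prod t
    & {in t, forall x, 0 < P.[x] * Q^`().[x]}].
Proof.
move=> us a0 p0 P Q Q0.
have [|] := boolP ((0 < a) || (s != [::])); last first.
  rewrite negb_or -leNgt negbK => /andP[a0' /eqP s0].
  have {a0 a0'} a0 : a = 0 by apply/eqP; rewrite eq_le a0 a0'.
  exists [::]; split => //.
  by rewrite /Q /P s0 a0 !big_nil scale0r add0r mulr1 subr0 lead_coefC alg_polyC.
move=> nz.
pose phi := real_complex R.
pose C : numClosedFieldType := R[i].
have [r rE] := closed_field_poly_normal (map_poly phi Q).
have QC0 : map_poly phi Q != 0 by rewrite map_poly_eq0.
have usC : uniq (map phi s) by rewrite map_inj_uniq //; apply: fmorph_inj.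
have phi_rem x : map phi (rem x s) = rem (phi x) (map phi s).
  elim: (s) => //= y s' IH; rewrite (inj_eq (fmorph_inj phi)).
  by case: eqP => //= _; rewrite IH.
have phi_prod u : map_poly phi (root_prod u) = root_prod (map phi u).
  rewrite rmorph_prod big_map; apply: eq_bigr => x _.
  by rewrite rmorphB /= map_polyX map_polyC.
(* the weights, extended to complex arguments through the real part *)
pose pC (z : C) := phi (p (complex.Re z)).
have QCE : map_poly phi Q = (phi a *: 'X + (phi b)%:P) * root_prod (map phi s)
    - \sum_(x <- map phi s) pC x *: root_prod (rem x (map phi s)).
  rewrite rmorphB rmorphM /= rmorphD /= map_polyZ /= map_polyX map_polyC /= phi_prod.
  congr (_ - _); rewrite rmorph_sum big_map; apply: eq_bigr => x _.
  by rewrite /= map_polyZ phi_prod phi_rem.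
have rre z : z \in r -> z = phi (complex.Re z).
  move=> zr.
  have rz : (map_poly phi Q).[z] = 0.
    by apply/eqP; rewrite -/(root _ _) rE rootZ ?lead_coef_eq0 // root_prod_XsubC.
  have rzc : (map_poly phi Q).[(z : C)^*] = 0.
    have -> : map_poly phi Q = map_poly (@Num.conj C) (map_poly phi Q).
      rewrite -map_poly_comp; apply: eq_map_poly => x /=.
      by apply/esym/CrealP; rewrite complex_real.
    by rewrite horner_map rz rmorph0.
  have hconj u : ((root_prod (map phi u)).[(z : C)^*]) = ((root_prod (map phi u)).[z] : C)^*.
    rewrite -horner_map /=; congr (_.[_]).
    rewrite -phi_prod -map_poly_comp; apply: eq_map_poly => x /=.
    by apply/esym/CrealP; rewrite complex_real.
  have := @bezoutian_partial_fractions C (map phi s) (phi a) (phi b) pC z ((z:C)^*).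
  rewrite /= -QCE rz rzc !mul0r subrr hconj -normCK.
  have -> : \sum_(x <- map phi s)
         pC x *  ((root_prod (rem x (map phi s))).[z] *
           (root_prod (rem x (map phi s))).[(z:C)^*]) =
      \sum_(x <- map phi s)
         pC x *  `|((root_prod (rem x (map phi s))).[z]) : C| ^+ 2.
    rewrite !big_map; apply: eq_bigr => x _.
    by rewrite -phi_rem hconj normCK.
  move/esym/eqP; rewrite mulf_eq0 subr_eq0 => /orP[/eqP zz|].
    have /CrealP : (z : C)^* = z by [].
    by move/complex_realP => [x ->].
  rewrite gt_eqF //; apply: bezoutian_diag_gt0 => //.
  - by rewrite -[0]/(phi 0) lecR.
  - by move=> _ /mapP[x xs ->]; rewrite -[0]/(phi 0) ltcR p0.
  - by rewrite -[0]/(phi 0) ltcR -size_eq0 size_map size_eq0.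
pose t := map (@complex.Re R) r.
have rt : r = map phi t.
  rewrite -map_comp -[LHS]map_id; apply/eq_in_map => z /rre; by [].
have QE : Q = lead_coef Q *: root_prod t.
  apply: (map_inj_poly (fmorph_inj phi) (rmorph0 _)).
  by rewrite map_polyZ phi_prod -rt {1}rE lead_coef_map.
have Pt : {in t, forall x, 0 < P.[x] * Q^`().[x]}.
  move=> x xt.
  have Qx : Q.[x] = 0.
    by apply/eqP; rewrite -/(root _ _) QE rootZ ?lead_coef_eq0 // root_prod_XsubC.
  have /(congr1 (horner^~ x)) := wronskian_partial_fractions s a b p.
  rewrite -/P -/Q hornerD hornerN !hornerM Qx mul0r subr0 [RHS]hornerD hornerZ horner_sum.
  rewrite mulrC => ->.
  have := @bezoutian_diag_gt0 R s a p x us a0 p0 nz.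
  rewrite real_normK ?num_real // horner_exp.
  congr (0 < _ + _); apply: eq_bigr => y _.
  by rewrite real_normK ?num_real // hornerZ horner_exp.
exists t; split => //.
apply: uniq_of_deriv_neq0 => x /Pt; apply: contraTneq => h.
by rewrite QE derivZ hornerZ h !mulr0 ltxx.
Qed.

(** * The derivative polynomials of powers of sech *)

(** One step of the recurrence of [f_m] in the variable u = x^2, on an even
    ([b = false]) or odd ([b = true]) polynomial: the image of x^b P(x^2) under
    f |-> (x^2 - 1) f' + c x f is x^(1 - b) times the value of this operator at
    x^2. *)
Definition sech_step (K : comNzRingType) (c : K) (b : bool) (P : {poly K}) :=
  'X^b * (2 *: (('X - 1) * P^`()) + c *: P) + (('X - 1) * P) *+ b.

(** The polynomial p_m with D^m (sech z)^c = +- t^(m mod 2) p_m(t^2) (sech z)^c,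
    where t = tanh z. *)
Fixpoint sech_poly (K : comNzRingType) (c : K) (m : nat) : {poly K} :=
  if m is m'.+1 then sech_step c (odd m') (sech_poly c m') else 1.

Section SechStep.
Variable R : rcfType.
Implicit Types (c k x : R) (b : bool) (P H : {poly R}) (s : seq R).

Lemma sech_stepD c b P H : sech_step c b (P + H) = sech_step c b P + sech_step c b H.
Proof. by case: b; rewrite /sech_step derivD -!mul_polyC ?mulr1n ?mulr0n; ring. Qed.

Lemma sech_stepZ c b k P : sech_step c b (k *: P) = k *: sech_step c b P.
Proof. by case: b; rewrite /sech_step derivZ -!mul_polyC ?mulr1n ?mulr0n; ring. Qed.

Lemma sech_step0 c b : sech_step c b 0 = 0.
Proof. by have := sech_stepZ c b 0 0; rewrite !scale0r. Qed.

Lemma sech_step_sum c b (I : Type) (r : seq I) (F : I -> {poly R}) :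
  sech_step c b (\sum_(i <- r) F i) = \sum_(i <- r) sech_step c b (F i).
Proof.
elim: r => [|i r IH]; first by rewrite !big_nil sech_step0.
by rewrite !big_cons sech_stepD IH.
Qed.

Lemma horner_deriv_root_prod s x : x \notin s ->
  (root_prod s)^`().[x] = (root_prod s).[x] * \sum_(y <- s) (x - y)^-1.
Proof.
move=> xs; rewrite deriv_root_prod horner_sum mulr_sumr; apply: eq_big_seq => y ys.
have xy : x - y != 0 by rewrite subr_eq0; apply: contraNneq xs => ->.
by rewrite (horner_root_prod_rem _ ys) mulrAC divff // mul1r.
Qed.

(** The decomposition to which [real_rooted_partial_fractions] applies; its
    weights 2 (1 - x) and 2 x (1 - x) are positive as long as the roots are in
    ]0, 1[. *)
Lemma sech_step_partial_fractions c b s :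
  sech_step c b (root_prod s) =
    (((2 * (size s)%:R + c + 1) *+ b) *: 'X +
      (if b then - 1 - \sum_(x <- s) 2 * (1 - x) else 2 * (size s)%:R + c)%:P) * root_prod s -
     \sum_(x <- s) ((if b then x else 1) * (2 * (1 - x))) *: root_prod (rem x s).
Proof.
have E : 2 *: (('X - 1) * (root_prod s)^`()) =
   (2 * (size s)%:R) *: root_prod s - \sum_(x <- s) (2 * (1 - x)) *: root_prod (rem x s).
  rewrite deriv_root_prod mulr_sumr scaler_sumr.
  rewrite -sum1_size natr_sum mulr_sumr scaler_suml -sumrB.
  apply: eq_big_seq => x xs.
  rewrite [in RHS](root_prod_rem xs) -!mul_polyC !polyCM polyCB !polyC1. ring.
case: b => /=.
  rewrite /sech_step E.
  have -> : \sum_(x <- s) (x * (2 * (1 - x))) *: root_prod (rem x s) =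
    'X * (\sum_(x <- s) (2 * (1 - x)) *: root_prod (rem x s)) -
      (\sum_(x <- s) 2 * (1 - x)) *: root_prod s.
    rewrite mulr_sumr scaler_suml -sumrB; apply: eq_big_seq => x xs.
    rewrite [in RHS](root_prod_rem xs) -!mul_polyC !polyCM polyCB !polyC1; ring.
  rewrite -!mul_polyC !mulr1n !polyCB !polyCD !polyCM polyCN polyC1; ring.
rewrite /sech_step E expr0 !mulr0n addr0 scale0r add0r mul1r.
rewrite -!mul_polyC [in RHS]polyCD [in RHS]mulrDl addrAC; congr (_ - _).
by apply: eq_bigr => x _; rewrite mul1r.
Qed.

Lemma coef_sech_step c b P r : (size P <= r.+1)%N ->
  (size (sech_step c b P) <= r.+1 + b)%N /\
  (sech_step c b P)`_(r + b) = (2 * r%:R + c + b%:R) * P`_r.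
Proof.
move=> sP.
pose U := 2 *: (('X - 1) * P^`()) + c *: P.
have cU i : U`_i = 2 * (P`_i *+ i - P`_i.+1 *+ i.+1) + c * P`_i.
  rewrite /U coefD !coefZ mulrBl mul1r coefB coefXM !coef_deriv.
  by case: i => [|i] //=; rewrite mulr0n.
have z i : (r < i)%N -> P`_i = 0 by move=> ri; rewrite nth_default // (leq_trans sP).
have sU : (size U <= r.+1)%N.
  by apply/leq_sizeP => i ri; rewrite cU !z ?(leqW ri) // !mul0rn subrr !mulr0 addr0.
have UE : U`_r = (2 * r%:R + c) * P`_r.
  by rewrite cU (z r.+1) // mul0rn subr0 mulrDl -[P`_r *+ r]mulr_natl; ring.
have -> : sech_step c b P = if b then 'X * U + ('X - 1) * P else U.
  by rewrite /sech_step; case: b; rewrite ?mulr1n // expr0 mul1r mulr0n addr0.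
case: b; last by rewrite /= !addn0 addr0.
have cV i : ('X * U + ('X - 1) * P)`_i.+1 = U`_i + P`_i - P`_i.+1.
  by rewrite coefD mulrBl mul1r coefB !coefXM /=; ring.
split.
  apply/leq_sizeP => [[|i]]; rewrite addn1 // ltnS => ri.
  by rewrite cV !z ?(leqW ri) // subr0 addr0 nth_default // (leq_trans sU).
by rewrite addn1 cV UE (z r.+1) //=; ring.
Qed.

Lemma size_sech_poly c m : 0 < c ->
  size (sech_poly c m) = m./2.+1 /\ 0 < lead_coef (sech_poly c m).
Proof.
move=> c0; suff [s l] : (size (sech_poly c m) <= m./2.+1)%N /\ 0 < (sech_poly c m)`_(m./2).
  suff e : size (sech_poly c m) = m./2.+1 by rewrite lead_coefE e.
  by apply/eqP; rewrite eqn_leq s ltnNge; apply: contraTN l => l; rewrite nth_default ?ltxx.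
elim: m => [|m [IH1 IH2]] /=; first by rewrite size_poly1 coefC.
have [] := coef_sech_step c (odd m) IH1.
rewrite uphalf_half addSn addnC => -> ->; split => //.
by rewrite mulr_gt0 // -!natrM ltr_wpDr // ltr_wpDl // -natrM.
Qed.

(** The zeros of the image are real and simple by the decomposition above.  At a
    zero x, with L = P'(x) / P(x), one has x^b (2 (x - 1) L + c) + b (x - 1) = 0.
    For x <= 0 or x >= 1 the numbers x - 1 and L have the same weak sign, so
    2 (x - 1) L + c > 0 and the left-hand side cannot vanish. *)
Lemma sech_step_split c b s k : 0 < c -> 0 < k -> uniq s ->
  {in s, forall x, 0 < x < 1} ->
  let P := k *: root_prod s in let Q := sech_step c b P in Q != 0 ->
  exists t, [/\ uniq t, {in t, forall x, 0 < x < 1}, Q = lead_coef Q *: root_prod t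
    & {in t, forall x, 0 < P.[x] * Q^`().[x]}].
Proof.
move=> c0 k0 us s01 P Q; rewrite /Q /P sech_stepZ => Q0.
have {}Q0 : sech_step c b (root_prod s) != 0 by apply: contraNneq Q0 => ->; rewrite scaler0.
have [|x xs||] := @real_rooted_partial_fractions R s ((2 * (size s)%:R + c + 1) *+ b)
  (if b then - 1 - \sum_(x <- s) 2 * (1 - x) else 2 * (size s)%:R + c)
  (fun x => (if b then x else 1) * (2 * (1 - x))) us.
- by rewrite mulrn_wge0 // !addr_ge0 ?ler01 ?mulr_ge0 ?ler0n // ltW.
- case/andP: (s01 x xs) => x0 x1; rewrite mulr_gt0 //; first by case: (b).
  by rewrite mulr_gt0 // subr_gt0.
- by rewrite -sech_step_partial_fractions.
rewrite -sech_step_partial_fractions => t [ut tE tP].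
have tP' x : x \in t ->
    0 < (k *: root_prod s).[x] * (k *: sech_step c b (root_prod s))^`().[x].
  by move=> /tP h; rewrite derivZ !hornerZ mulrACA mulr_gt0 // mulr_gt0.
exists t; split => //; last by rewrite lead_coefZ -scalerA -tE.
move=> x xt.
have xs : x \notin s.
  by apply: contraTN (tP x xt) => xs; rewrite root_prod_eval0 // mul0r ltxx.
have P0 : (root_prod s).[x] != 0 by rewrite -/(root _ _) root_prod_XsubC.
have : (sech_step c b (root_prod s)).[x] = 0.
  by rewrite tE hornerZ root_prod_eval0 // mulr0.
rewrite /sech_step hornerD hornerMn !hornerM horner_exp hornerD !hornerZ hornerM.
rewrite hornerD hornerN hornerX hornerC horner_deriv_root_prod //.
set L := \sum_(y <- s) _; set p := (root_prod s).[x].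
have -> : x ^+ b * (2 * ((x - 1) * (p * L)) + c * p) + (x - 1) * p *+ b =
   p * (x ^+ b * (2 * ((x - 1) * L) + c) + (x - 1) *+ b).
  by case: (b); rewrite ?mulr1n ?mulr0n; ring.
move/eqP; rewrite mulf_eq0 (negPf P0) /= => /eqP e.
rewrite !ltNge -negb_or; apply/negP => /orP x01.
have L0 : 0 <= (x - 1) * L.
  case: x01 => h.
    rewrite mulr_le0 ?subr_le0 //; first by rewrite (le_trans h).
    rewrite /L big_seq; apply: sumr_le0 => y ys; rewrite invr_le0 subr_le0.
    by case/andP: (s01 y ys) => /ltW y0 _; apply: le_trans h y0.
  rewrite mulr_ge0 ?subr_ge0 //.
  rewrite /L big_seq; apply: sumr_ge0 => y ys; rewrite invr_ge0 subr_ge0.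
  by case/andP: (s01 y ys) => _ /ltW y0; apply: le_trans y0 h.
clear -e x01 L0 c0; case: b e => /=; rewrite ?expr1 ?expr0 ?mulr1n ?mulr0n => e.
  case: x01 => h; nra.
lra.
Qed.

Lemma sech_poly_split c m : 0 < c -> exists s,
  [/\ uniq s, {in s, forall x, 0 < x < 1}, size s = m./2 &
     sech_poly c m = lead_coef (sech_poly c m) *: root_prod s].
Proof.
move=> c0.
suff [s [us s01 sE]] : exists s, [/\ uniq s, {in s, forall x, 0 < x < 1} &
     sech_poly c m = lead_coef (sech_poly c m) *: root_prod s].
  exists s; split => //; have [sz l] := size_sech_poly m c0.
  by move: sz; rewrite sE size_scale ?gt_eqF // size_prod_XsubC => [[]].
elim: m => [|m [s [us s01 sE]]].
  by exists [::]; split => //; rewrite big_nil lead_coef1 scale1r.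
have [sz l] := size_sech_poly m c0; have [sz' _] := size_sech_poly m.+1 c0.
have [|t [ut t01 tE _]] := @sech_step_split c (odd m) s _ c0 l us s01.
  by rewrite -sE -/(sech_poly c m.+1) -size_poly_eq0 sz'.
by exists t; split => //; move: tE; rewrite -sE.
Qed.

Lemma sech_poly_root_sign c m x : 0 < c -> root (sech_poly c m.+1) x ->
  0 < (sech_poly c m).[x] * (sech_poly c m.+1)^`().[x].
Proof.
move=> c0 rx; have [s [us s01 _ sE]] := sech_poly_split m c0.
have [sz l] := size_sech_poly m c0; have [sz' l'] := size_sech_poly m.+1 c0.
have [|t [ut t01 tE tP]] := @sech_step_split c (odd m) s _ c0 l us s01.
  by rewrite -sE -/(sech_poly c m.+1) -size_poly_eq0 sz'.
rewrite -sE -/(sech_poly c m.+1) in tE tP; apply: tP.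
by move: rx; rewrite tE rootZ ?gt_eqF // root_prod_XsubC.
Qed.

End SechStep.

(** * Monotonicity in the exponent *)

Lemma horner_deriv_root_prod_root (K : idomainType) (s : seq K) (x : K) : x \in s ->
  (root_prod s)^`().[x] = (root_prod (rem x s)).[x].
Proof.
move=> xs; rewrite {1}(root_prod_rem xs) derivM derivXsubC mul1r hornerD hornerM.
by rewrite hornerXsubC subrr mul0r addr0.
Qed.

(** Lagrange interpolation at the points of [s], with one extra coefficient for
    the degree size s. *)
Lemma lagrange_partial_fractions (K : fieldType) (s : seq K) (H : {poly K}) :
  uniq s -> (size H <= (size s).+1)%N ->
  H = H`_(size s) *: root_prod s +
      \sum_(x <- s) (H.[x] / (root_prod s)^`().[x]) *: root_prod (rem x s).
Proof.
move=> us sH; apply/eqP; rewrite -subr_eq0 opprD addrA; apply/eqP.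
set D := _ - _; apply: (@roots_geq_poly_eq0 _ D s) => //.
  apply/allP => z zs; rewrite /root /D hornerD !hornerN hornerD hornerN hornerZ horner_sum.
  rewrite root_prod_eval0 // mulr0 subr0.
  have -> (F : K -> K) : \sum_(x <- s) F x = F z + \sum_(x <- rem z s) F x.
    exact: big_rem.
  rewrite hornerZ -horner_deriv_root_prod_root // divfK; last first.
    by rewrite horner_deriv_root_prod_root //; apply: horner_root_prod_rem_neq0 => //; right.
  rewrite opprD addrA subrr sub0r oppr_eq0; apply/eqP/big1_seq => x /= xz.
  have xs := mem_rem xz.
  rewrite hornerZ root_prod_eval0 ?mulr0 // mem_rem_uniq // inE zs andbT.
  by apply: contraTneq xz => ->; rewrite mem_rem_uniq // !inE eqxx.
apply/leq_sizeP => j sj; rewrite /D coefB coefB coefZ coef_sum.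
rewrite [X in _ - X]big1_seq ?subr0; last first.
  move=> x /= xs; rewrite coefZ nth_default ?mulr0 // size_prod_XsubC size_rem //.
  by apply: leq_trans sj; case: (s) xs.
have sP : size (root_prod s) = (size s).+1 by rewrite size_prod_XsubC.
move: sj; rewrite leq_eqVlt => /orP[/eqP<-|sj].
  have /monicP := monic_prod_XsubC s xpredT (fun x => x).
  by rewrite lead_coefE sP /= => ->; rewrite mulr1 subrr.
by rewrite (nth_default _ (leq_trans sH sj)) [(root_prod s)`_j]nth_default ?sP // mulr0 subrr.
Qed.

Section Monotonicity.
Variable R : rcfType.
Implicit Types (c k x : R) (b : bool) (P H : {poly R}) (s : seq R).

Lemma sech_step_add2 c b P : sech_step (c + 2) b P = sech_step c b P + 2 *: ('X^b * P).
Proof. by case: b; rewrite /sech_step -!mul_polyC ?mulr1n ?mulr0n polyCD; ring. Qed.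

Lemma sech_stepM c b P H :
  (sech_step c b (P * H)) = P * sech_step c b H + 2 *: ('X^b * (('X - 1) * (P^`() * H))).
Proof. by case: b; rewrite /sech_step derivM -!mul_polyC ?mulr1n ?mulr0n; ring. Qed.

(** The operator is a derivation up to a multiplication, so the step of exponent c
    applied to P = (X - x) P_x expresses its value on P_x at a zero z of the image
    of P.  Passing from c to c + 2 adds 2 z^b P_x(z), and (1 - z) + (z - x) = 1 - x
    gives the total the sign of P(z). *)
Lemma sech_step_shift_rem c b s x z : uniq s -> x \in s -> z \notin s ->
  (sech_step c b (root_prod s)).[z] = 0 ->
  (sech_step (c + 2) b (root_prod (rem x s))).[z] =
    2 * z ^+ b * (root_prod s).[z] * ((1 - x) / (z - x) ^+ 2).
Proof.
move=> us xs zs; rewrite sech_step_add2 (root_prod_rem xs) sech_stepM derivXsubC.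
have zx : z - x != 0 by rewrite subr_eq0; apply: contraNneq zs => ->.
move: (sech_step c b _) => V.
rewrite !(hornerD, hornerN, hornerM, hornerZ, hornerX, hornerC, horner_exp) mul1r.
set u := V.[z]; set p := (root_prod _).[z] => e.
have -> : u = - (2 * (z ^+ b * ((z - 1) * p))) / (z - x).
  by apply: (mulIf zx); rewrite divfK // mulrC; apply/eqP; rewrite -addr_eq0 e.
by field.
Qed.

(** The zeros move towards 0 when c grows.  Suppose the sign known at the zeros
    y of P = p_m; then H = p_m[c + 2] is a positive multiple of P plus positive
    multiples of the P / (X - y).  By [sech_step_shift_rem] the next step of H has
    the sign of P at each zero x of p_(m+1), which is the sign of p_(m+1)'(x) by
    [sech_poly_root_sign]. *)
Lemma sech_poly_shift_sign c m x : 0 < c -> root (sech_poly c m) x ->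
  0 < (sech_poly (c + 2) m).[x] * (sech_poly c m)^`().[x].
Proof.
move=> c0; have c20 : 0 < c + 2 by rewrite addr_gt0.
elim: m x => [|m IH] x; first by rewrite /= -[root _ _]negbK root1.
move=> rx; have sg := sech_poly_root_sign c0 rx.
have [s [us s01 ss sE]] := sech_poly_split m c0.
have [sz l] := size_sech_poly m c0; have [sz2 l2] := size_sech_poly m c20.
have [t [ut t01 _ tE]] := sech_poly_split m.+1 c0.
have [_ l'] := size_sech_poly m.+1 c0.
have x0 : 0 < x.
  move: rx; rewrite tE rootZ ?gt_eqF // root_prod_XsubC => /t01; by case/andP.
have xs : x \notin s.
  by apply: contraTN sg => xs; rewrite sE hornerZ root_prod_eval0 // mulr0 mul0r ltxx.
set H := sech_poly (c + 2) m in IH sz2 l2 *.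
have HE := @lagrange_partial_fractions _ s H us.
rewrite ss sz2 leqnn in HE; have {}HE := HE isT.
have e0 : (sech_step c (odd m) (root_prod s)).[x] = 0.
  move: rx; rewrite /root /= sE sech_stepZ hornerZ mulf_eq0 gt_eqF //= => /eqP; exact.
have Hx : (sech_poly (c + 2) m.+1).[x] = 2 * x ^+ odd m * (root_prod s).[x] *
   (H`_(m./2) + \sum_(y <- s) (H.[y] / (root_prod s)^`().[y]) * ((1 - y) / (x - y) ^+ 2)).
  rewrite /= -/H HE sech_stepD sech_stepZ sech_step_sum hornerD hornerZ horner_sum.
  rewrite mulrDr; congr (_ + _).
    rewrite sech_step_add2 hornerD e0 add0r hornerZ hornerM horner_exp hornerX mulrA -HE; ring.
  rewrite mulr_sumr; apply: eq_big_seq => y ys.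
  rewrite sech_stepZ hornerZ (sech_step_shift_rem us ys xs e0) -HE; ring.
rewrite Hx; set S := _ + _.
have S0 : 0 < S.
  rewrite ltr_wpDr //; last by move: l2; rewrite lead_coefE sz2.
  rewrite big_seq; apply: sumr_ge0 => y ys; rewrite mulr_ge0 //; last first.
    by rewrite divr_ge0 ?sqr_ge0 // subr_ge0; case/andP: (s01 y ys) => _ /ltW.
  have /IH : root (sech_poly c m) y by rewrite sE rootZ ?gt_eqF // root_prod_XsubC.
  rewrite sE derivZ hornerZ mulrCA pmulr_rgt0 // => /ltW h.
  have -> : H.[y] / (root_prod s)^`().[y] =
     H.[y] * (root_prod s)^`().[y] / ((root_prod s)^`().[y]) ^+ 2.
    have [->|d0] := eqVneq (root_prod s)^`().[y] 0; first by rewrite invr0 !mulr0 mul0r.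
    by field.
  by rewrite divr_ge0 ?sqr_ge0.
move: sg; rewrite sE hornerZ -mulrA pmulr_rgt0 // => sg.
have reorder (r u v w y : R) : r * u * v * w * y = r * u * w * (v * y) by ring.
by rewrite reorder mulr_gt0 // mulr_gt0 // mulr_gt0 ?ltr0n // exprn_gt0.
Qed.

(** This is D^2 (sech z)^c = c^2 (sech z)^c - c (c + 1) (sech z)^(c + 2),
    differentiated m times: multiplication by 1 - X, that is by (sech z)^2,
    intertwines the steps of exponents c and c + 2. *)
Lemma sech_poly_step2 c m : sech_poly c m.+2 =
  c ^+ 2 *: sech_poly c m - (c * (c + 1)) *: ((1 - 'X) * sech_poly (c + 2) m).
Proof.
elim: m => [|m IH].
  have d1 : (1 : {poly R})^`() = 0 by rewrite -polyC1 derivC.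
  have p1 : sech_poly c 1 = c%:P.
    by rewrite /= /sech_step d1 !mulr0 scaler0 add0r mulr0n addr0 expr0 mul1r alg_polyC.
  rewrite [LHS]/= -/(sech_poly c 1) p1 /sech_step /= derivC expr1 mulr1n.
  rewrite -!mul_polyC !polyCM polyCD polyC1; ring.
rewrite [LHS]/= -/(sech_poly c m.+2) IH /= negbK.
rewrite sech_stepD -scaleNr !sech_stepZ sech_step_add2 sech_stepM.
rewrite derivD derivN derivX derivC -!mul_polyC; ring.
Qed.

Lemma sech_poly_step2_sign c m x : 0 < c -> root (sech_poly c m) x ->
  (sech_poly c m.+2).[x] * (sech_poly c m)^`().[x] < 0.
Proof.
move=> c0 rx; have sg := sech_poly_shift_sign c0 rx.
have [s [us s01 ss sE]] := sech_poly_split m c0; have [sz l] := size_sech_poly m c0.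
have /andP[x0 x1] : 0 < x < 1.
  by apply: s01; move: rx; rewrite sE rootZ ?gt_eqF // root_prod_XsubC.
rewrite sech_poly_step2 !(hornerD, hornerN, hornerM, hornerZ, hornerX, hornerC) (eqP rx).
rewrite mulr0 add0r -!mulNr -!mulrA nmulr_rlt0 ?oppr_lt0 //.
by rewrite pmulr_rgt0 ?addr_gt0 // pmulr_rgt0 // subr_gt0.
Qed.

End Monotonicity.

(** * Interlacing from signs *)

Section Interlacing.
Variable R : realDomainType.
Implicit Types (s a b : seq R) (x : R).

Lemma sgr_root_prod s x : x \notin s ->
  Num.sg (root_prod s).[x] = (-1) ^+ count (> x) s.
Proof.
elim: s => [|y s IH]; first by rewrite big_nil hornerC sgr1.
rewrite inE negb_or big_cons hornerM hornerXsubC sgrM => /andP[xy /IH->].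
rewrite /= exprD; congr (_ * _); case: (ltgtP x y) xy => // h _.
  by rewrite ltr0_sg ?subr_lt0.
by rewrite gtr0_sg ?subr_gt0.
Qed.

Lemma count_gt_le s i x : sorted <%R s -> (i < size s)%N -> s`_i <= x ->
  (count (> x) s <= size s - i.+1)%N.
Proof.
move=> ss is_ ix; rewrite -{1}(cat_take_drop i.+1 s) count_cat -(size_drop i.+1 s).
rewrite [X in (X + _)%N](_ : _ = 0%N) ?count_size //.
apply/eqP; rewrite -leqn0 leqNgt -has_count; apply/hasPn => y /(nthP 0)[j].
rewrite size_takel // => hj <-; rewrite nth_take // -leNgt; apply: le_trans ix.
by rewrite (lt_sorted_leq_nth 0 ss) ?inE // (leq_trans hj).
Qed.

Lemma count_gt_ge s i x : sorted <%R s -> (i < size s)%N -> x < s`_i ->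
  (size s - i <= count (> x) s)%N.
Proof.
move=> ss is_ ix; rewrite -{2}(cat_take_drop i s) count_cat -(size_drop i s).
apply: leq_trans (leq_addl _ _); rewrite leq_eqVlt eq_sym -all_count.
apply/orP; left; apply/allP => y /(nthP 0)[j]; rewrite size_drop => hj <-.
rewrite nth_drop; apply: lt_le_trans ix _.
by rewrite (lt_sorted_leq_nth 0 ss) ?inE ?leq_addr // -ltn_subRL.
Qed.

Lemma count_gt_nth s i : sorted <%R s -> (i < size s)%N ->
  count (> s`_i) s = (size s - i.+1)%N.
Proof.
move=> ss is_; apply/eqP; rewrite eqn_leq count_gt_le //=.
have [l|l] := leqP (size s) i.+1; first by move: l; rewrite -subn_eq0 => /eqP->.
by apply: count_gt_ge => //; rewrite (lt_sorted_ltn_nth 0 ss) ?inE.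
Qed.

(** Let N i be the number of points of [b] above the i-th point of [a].  The
    sign hypothesis gives N i the parity of size a - i.  So the nonincreasing
    sequence N is strictly decreasing; it ends with an odd, hence positive, value
    and starts at most at size a, by parity.  Hence N i = size a - i. *)
Lemma interlace_of_signs a b : sorted <%R a -> sorted <%R b ->
  size b = (size a).+1 ->
  {in a, forall x, (root_prod b).[x] * (root_prod a)^`().[x] < 0} ->
  forall i, (i < size a)%N -> b`_i < a`_i < b`_i.+1.
Proof.
move=> sa sb sz sg.
have ua : uniq a by apply: lt_sorted_uniq sa.
pose N i := count (> a`_i) b.
have anb x : x \in a -> x \notin b.
  by move=> /sg; apply: contraTN => xb; rewrite root_prod_eval0 // mul0r ltxx.
have par i : (i < size a)%N -> odd (N i) = odd (size a - i).
  move=> ia; have xa : a`_i \in a by rewrite mem_nth.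
  have := sg _ xa; rewrite -sgr_lt0 sgrM sgr_root_prod ?anb //.
  rewrite horner_deriv_root_prod_root // sgr_root_prod ?mem_rem_uniq ?inE ?eqxx //.
  have -> : count (> a`_i) (rem a`_i a) = (size a - i.+1)%N.
    by rewrite count_rem xa /= ltxx subn0 count_gt_nth.
  rewrite -/(N i) -exprD -signr_odd oddD; case: (odd (N i)); case e : (odd _);
    rewrite /= ?expr0 ?ltr10 ?expr1 // => _;
    rewrite (_ : size a - i = (size a - i.+1).+1)%N; lia.
have mono i : (i.+1 < size a)%N -> (N i.+1 <= N i)%N.
  move=> ia; apply: sub_count => y /=; apply: lt_trans.
  by rewrite (lt_sorted_ltn_nth 0 sa) ?inE // ltnW.
have lo k : forall i, (i + k.+1 = size a)%N -> (k < N i)%N.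
  elim: k => [|k IH] i e; have := par i; first lia.
  have := IH i.+1; have := mono i; lia.
have up i : (i < size a)%N -> (N i <= size a - i)%N.
  elim: i => [|i IH] ia; have := par _ ia.
    have : (N 0 <= size b)%N by apply: count_size.
    lia.
  have := mono _ ia; have := IH (ltnW ia); lia.
move=> i ia; have xa : a`_i \in a by rewrite mem_nth.
have Ni : N i = (size a - i)%N by have := up _ ia; have := lo (size a - i).-1 i; lia.
have ib j : (j <= size a)%N -> a`_i != b`_j.
  by move=> jb; apply: contraNneq (anb _ xa) => ->; rewrite mem_nth // sz.
apply/andP; split.
  rewrite ltNge le_eqVlt (negPf (ib _ (ltnW ia))) /=; apply/negP => h.
  have := count_gt_ge sb _ h; rewrite -/(N i); lia.
rewrite ltNge; apply/negP => h.
have := count_gt_le sb _ h; rewrite -/(N i); lia.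
Qed.

End Interlacing.

(** * The Eulerian triangles *)

Section Triangle.
Variables (R : realFieldType) (c : R).

(** For c = 1 these are the Eulerian numbers of type B, and for c = 2 the
    numbers 2^m <m + 1, k> of type A; the common recurrence is the one satisfied
    by the coefficients of 2^m f_m in the family (x - 1)^k (x + 1)^(m - k). *)
Fixpoint eulerian_triangle (m k : nat) : R :=
  if m is m'.+1 then
    (c + 2 * k%:R) * eulerian_triangle m' k +
    (if k is k'.+1 then (c + 2 * (m'%:R - k'%:R)) * eulerian_triangle m' k' else 0)
  else (k == 0%N)%:R.

Lemma eulerian_triangle_gt m k : (m < k)%N -> eulerian_triangle m k = 0.
Proof.
elim: m k => [|m IH] [|k] //= mk.
by rewrite !IH ?mulr0 ?addr0 // ltnW.
Qed.

Lemma eulerian_triangle_sym m i j : (i + j = m)%N ->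
  eulerian_triangle m i = eulerian_triangle m j.
Proof.
elim: m i j => [|m IH] [|i] [|j] //; rewrite ?addn0 ?add0n; try lia.
- move=> [->] /=; rewrite (eulerian_triangle_gt (ltnSn m)) (IH 0%N m) // subrr; ring.
- move=> [->] /=; rewrite (eulerian_triangle_gt (ltnSn m)) (IH m 0%N) ?addn0 // subrr; ring.
move=> e /=; rewrite (IH i.+1 j); last lia.
rewrite (IH i j.+1); last lia.
have -> : (m%:R : R) = i%:R + j%:R + 1 by rewrite -natrD natr1; congr _%:R; lia.
by rewrite -!natr1; ring.
Qed.

(** The polynomial (x + 1)^m E((x - 1) / (x + 1)), where E is the generating
    polynomial of the m-th row. *)
Definition homogenized_eulerian (m : nat) : {poly R} :=
  \sum_(k < m.+1) eulerian_triangle m k *: (('X - 1) ^+ k * ('X + 1) ^+ (m - k)).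

(** On the basis element M of index k, as 2 X = (X - 1) + (X + 1), the operator
    2 ((X^2 - 1) D + c X) gives
    (c + 2 k) (X + 1) M + (c + 2 (m - k)) (X - 1) M: the two coefficients of the
    triangle. *)
Lemma homogenized_eulerian_rec m : homogenized_eulerian m.+1 =
  2 *: (('X ^+ 2 - 1) * (homogenized_eulerian m)^`() + c *: ('X * homogenized_eulerian m)).
Proof.
pose M m k : {poly R} := ('X - 1) ^+ k * ('X + 1) ^+ (m - k).
have TM k : (k <= m)%N ->
  2 *: (('X ^+ 2 - 1) * (M m k)^`() + c *: ('X * M m k)) =
  (c + 2 * k%:R) *: M m.+1 k + (c + 2 * (m%:R - k%:R)) *: M m.+1 k.+1.
  move=> km; rewrite /M subSS subSn // -natrB //.
  move: (m - k)%N => j.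
  have dX (a : R) i : ('X + a%:P) * (('X + a%:P) ^+ i)^`() = i%:R *: ('X + a%:P) ^+ i.
    rewrite deriv_exp derivD derivX derivC addr0 mul1r.
    by case: i => [|i]; rewrite ?mulr0n ?mulr0 ?scale0r // exprS scaler_nat mulrnAr.
  have := dX 1 j; have := dX (- 1) k; rewrite polyCN polyC1.
  rewrite derivM ![_ ^+ k.+1]exprS ![_ ^+ j.+1]exprS; move: (_ ^+ k) (_ ^+ j) => A B eA eB.
  rewrite -[in RHS]mul_polyC -[in X in _ = _ + X]mul_polyC !polyCD !polyCM.
  have -> : ('X ^+ 2 - 1) * (A^`() * B + A * B^`()) =
     ('X + 1) * B * (('X - 1) * A^`()) + ('X - 1) * A * (('X + 1) * B^`()) by ring.
  rewrite eA eB -!mul_polyC; ring.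
transitivity (\sum_(k < m.+1) eulerian_triangle m k *:
    ((c + 2 * k%:R) *: M m.+1 k + (c + 2 * (m%:R - k%:R)) *: M m.+1 k.+1)).
  under [RHS]eq_bigr do rewrite scalerDr.
  rewrite [RHS]big_split /= /homogenized_eulerian.
  transitivity (\sum_(k < m.+2) ((c + 2 * k%:R) * eulerian_triangle m k) *: M m.+1 k +
    \sum_(k < m.+2) (if nat_of_ord k is k'.+1 then
       (c + 2 * (m%:R - k'%:R)) * eulerian_triangle m k' else 0) *: M m.+1 k).
    by rewrite -big_split /=; apply: eq_bigr => k _; rewrite -scalerDl.
  congr (_ + _).
    rewrite big_ord_recr /= eulerian_triangle_gt // mulr0 scale0r addr0.
    by apply: eq_bigr => k _; rewrite scalerA mulrC.
  rewrite big_ord_recl /= scale0r add0r.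
  by apply: eq_bigr => k _; rewrite scalerA mulrC.
rewrite /homogenized_eulerian raddf_sum !mulr_sumr scaler_sumr -big_split scaler_sumr /=.
apply: eq_bigr => k _; have km : (k <= m)%N by rewrite -ltnS.
rewrite -(TM k km) derivZ -/(M m k); move: (M m k) => A.
rewrite -!mul_polyC; ring.
Qed.

Lemma sech_step_comp (b : bool) (P : {poly R}) :
  ('X ^+ 2 - 1) * ('X^b * (P \Po 'X^2))^`() + c *: ('X * ('X^b * (P \Po 'X^2))) =
  'X^(~~ b) * (sech_step c b P \Po 'X^2).
Proof.
have cZ (a : R) (p : {poly R}) : (a *: p) \Po 'X^2 = a%:P * (p \Po 'X^2).
  by rewrite comp_polyZ mul_polyC.
have cU (p : {poly R}) : (('X - 1) * p) \Po 'X^2 = ('X^2 - 1) * (p \Po 'X^2).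
  by rewrite comp_polyM comp_polyB comp_polyX -polyC1 comp_polyC.
rewrite derivM deriv_comp (derivXn _ 2) /= expr1.
rewrite /sech_step comp_polyD comp_polyM comp_polyD !cZ cU.
case: b => /=; rewrite ?mulr1n ?mulr0n ?expr1 ?expr0 ?derivX ?cU ?comp_polyX ?comp_poly0.
  rewrite -mul_polyC; move: (_ \Po _) (_ \Po _) => A B; ring.
rewrite -polyC1 derivC comp_polyC !polyC1.
rewrite -mul_polyC; move: (_ \Po _) (_ \Po _) => A B; ring.
Qed.

Lemma homogenized_eulerianE m :
  homogenized_eulerian m = 2 ^+ m *: ('X^(odd m) * (sech_poly c m \Po 'X^2)).
Proof.
elim: m => [|m IH].
  rewrite /homogenized_eulerian big_ord_recl big_ord0 /= !expr0.
  by rewrite -polyC1 comp_polyC polyC1 !mulr1 addr0 !scale1r.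
rewrite homogenized_eulerian_rec IH [2 ^+ m.+1]exprS -[RHS]scalerA; congr (2 *: _).
rewrite [sech_poly c m.+1]/= -sech_step_comp derivZ; move: ('X^(odd m) * _) => A.
rewrite -!mul_polyC; ring.
Qed.

End Triangle.

Lemma coef_exp_Xadd1 (K : comNzRingType) n j : (('X + 1 : {poly K}) ^+ n)`_j = 'C(n, j)%:R.
Proof.
rewrite addrC exprDn coef_sum.
have -> : \sum_(i < n.+1) (1 ^+ (n - i) * 'X^i *+ 'C(n, i) : {poly K})`_j =
   \sum_(i < n.+1 | j == i :> nat) 'C(n, i)%:R.
  rewrite [RHS]big_mkcond; apply: eq_bigr => i _.
  by rewrite expr1n mul1r coefMn coefXn; case: eqP; rewrite ?mul0rn.
have [jn|nj] := ltnP j n.+1; last first.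
  by rewrite bin_small // big1 // => i /eqP e; have := ltn_ord i; lia.
by rewrite (big_pred1 (Ordinal jn)) // => i; rewrite -val_eqE /= eq_sym.
Qed.

Lemma coef_comp_oppX (K : comNzRingType) (p : {poly K}) j :
  (p \Po - 'X)`_j = (-1) ^+ j * p`_j.
Proof.
elim/poly_ind: p j => [|p a IH] j; first by rewrite comp_poly0 coef0 mulr0.
rewrite comp_polyD comp_polyM comp_polyX comp_polyC mulrN !coefD coefN !coefMX !coefC.
case: j => [|j] /=; first by rewrite oppr0 expr0 !add0r mul1r.
by rewrite !addr0 IH exprS mulN1r mulNr.
Qed.

(** The substitution of - X for X exchanges the two products up to the sign
    (-1)^(i + j). *)
Lemma coef_odd_reflect (K : comNzRingType) i j t :
  odd (i + j) ->
  (('X - 1 : {poly K}) ^+ i * ('X + 1) ^+ j)`_(2 * t + 1) =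
  (('X - 1 : {poly K}) ^+ j * ('X + 1) ^+ i)`_(2 * t + 1).
Proof.
move=> o.
have -> : ('X - 1 : {poly K}) ^+ i * ('X + 1) ^+ j =
    - ((('X - 1) ^+ j * ('X + 1) ^+ i) \Po - 'X).
  rewrite rmorphM !rmorphXn /= comp_polyB comp_polyD comp_polyX -polyC1 comp_polyC polyC1.
  rewrite -opprD [(- ('X + 1)) ^+ _]exprNn (_ : - 'X + 1 = - ('X - 1));
    last by rewrite opprB addrC.
  rewrite [(- ('X - 1)) ^+ _]exprNn mulrACA -exprD -signr_odd addnC o.
  by rewrite expr1 mulN1r opprK mulrC.
rewrite coefN coef_comp_oppX.
by rewrite -signr_odd oddD oddM /= expr1 mulN1r opprK.
Qed.

(** The inner sum of the statement is a coefficient of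
    (1 - X^2)^k (1 + X)^(2 n - 2 k - 1). *)
Lemma coef_inner_sum (R : realType) n k t : (k < n)%N ->
  (('X - 1 : {poly R}) ^+ k * ('X + 1) ^+ (2 * n - 1 - k))`_(2 * t + 1) =
  (-1) ^+ k * \sum_(i < k.+1) (-1) ^+ i * 'C(k, i)%:R *
      (binz (2 * n - 2 * k - 1) ((2 * t)%:Z - (2 * i)%:Z + 1))%:R.
Proof.
move=> kn.
have -> : (2 * n - 1 - k = k + (2 * n - 2 * k - 1))%N by lia.
rewrite exprD mulrA -exprMn (_ : ('X - 1) * ('X + 1) = - 1 + 'X^2); last by ring.
rewrite exprDn mulr_suml coef_sum mulr_sumr; apply: eq_bigr => i _.
rewrite mulrnAl coefMn -exprM -[_ *+ _]mulr_natr.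
have ik : (i <= k)%N by rewrite -ltnS.
have -> : (- 1) ^+ (k - i) = ((- 1) ^+ k * (- 1) ^+ i)%:P :> {poly R}.
  rewrite -exprD (_ : (k + i = k - i + 2 * i)%N); last lia.
  by rewrite exprD exprM sqrrN !expr1n mulr1 rmorphXn rmorphN rmorph1.
rewrite -[_ * _ * ('X + 1) ^+ _]mulrA coefCM coefXnM coef_exp_Xadd1.
have -> : (binz (2 * n - 2 * k - 1) ((2 * t)%:Z - (2 * i)%:Z + 1)) =
  if (2 * t + 1 < 2 * i)%N then 0%N else 'C(2 * n - 2 * k - 1, 2 * t + 1 - 2 * i).
  case: ifP => h.
    have -> : (2 * t)%:Z - (2 * i)%:Z + 1 = Negz (2 * i - 2 * t - 2) by lia.
    by [].
  have -> : (2 * t)%:Z - (2 * i)%:Z + 1 = Posz (2 * t + 1 - 2 * i) by lia.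
  by [].
by case: ifP => _; rewrite ?mulr0 ?mul0r //; ring.
Qed.

(** The terms of indices k and 2 n - 1 - k of the homogenized polynomial have the
    same odd coefficients, so the sum over k < n is half of the whole.  The factor
    [a] rescales the Eulerian numbers of type A. *)
Lemma eulerian_coefE (R : realType) (c a : R) (E : nat -> R) n t : (0 < n)%N ->
  (forall k, (k < n)%N -> a * E k = eulerian_triangle c (2 * n - 1) k) ->
  a * eulerian_coef E n t = 2 ^+ (2 * n - 2) * (sech_poly c (2 * n - 1))`_t.
Proof.
move=> n0 aE.
have om : odd (2 * n - 1) by lia.
have := congr1 (fun p : {poly R} => p`_(2 * t + 1)) (homogenized_eulerianE c (2 * n - 1)).
rewrite /= coefZ om expr1 addn1 coefXM /= coef_comp_poly_Xn // dvdn_mulr // mulKn //.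
rewrite [in X in _ = X * _](_ : 2 * n - 1 = (2 * n - 2).+1)%N; last lia.
rewrite exprS -mulrA => h; apply: (@mulfI _ (2 : R)); first by rewrite pnatr_eq0.
rewrite -h /homogenized_eulerian coef_sum.
rewrite (_ : (2 * n - 1).+1 = n + n)%N; last lia.
rewrite big_split_ord /=.
have e1 : a * eulerian_coef E n t = \sum_(i < n)
     (eulerian_triangle c (2 * n - 1) i *:
       (('X - 1) ^+ i * ('X + 1) ^+ (2 * n - 1 - i)))`_(2 * t).+1.
  rewrite /eulerian_coef mulr_sumr; apply: eq_bigr => i _.
  rewrite coefZ -aE // -[(2 * t).+1]addn1 coef_inner_sum //; ring.
rewrite -e1 mulrDl mul1r; congr (_ + _).
rewrite e1 (reindex_inj rev_ord_inj) /=; apply: eq_bigr => i _.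
have hi := ltn_ord i.
rewrite !coefZ -[(2 * t).+1]addn1 (_ : 2 * n - 1 - (n + i) = n - i.+1)%N; last lia.
rewrite (_ : 2 * n - 1 - (n - i.+1) = n + i)%N; last lia.
rewrite (@eulerian_triangle_sym _ _ (2 * n - 1) _ (n + i)); last lia.
by rewrite coef_odd_reflect //; lia.
Qed.

Lemma comp_sech_poly_sum (R : realType) (c : R) n : 0 < c -> (0 < n)%N ->
  sech_poly c (2 * n - 1) \Po 'X^2 = \sum_(t < n) (sech_poly c (2 * n - 1))`_t *: 'X^(2 * t).
Proof.
move=> c0 n0; have [sz _] := size_sech_poly (2 * n - 1) c0.
rewrite comp_polyE sz (_ : (2 * n - 1)./2.+1 = n); last lia.
by apply: eq_bigr => t _; rewrite -exprM.
Qed.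

(** * Type A: insertion of the largest value *)

Section Words.
Local Open Scope nat_scope.

(** The 0 in front of the word never creates a descent, so that a word of length
    n has n marks and no case distinction is needed for the empty word. *)
Definition word_descents (w : seq nat) : seq bool := pairmap (fun x y => y < x) 0 w.

Definition perm_word (m : nat) (s : 'S_m) : seq nat := [seq val (s i) | i <- enum 'I_m].

Lemma size_perm_word m (s : 'S_m) : size (perm_word s) = m.
Proof. by rewrite size_map size_enum_ord. Qed.

Lemma nth_perm_word m (s : 'S_m) (i : 'I_m) : nth 0 (perm_word s) i = s i.
Proof. by rewrite (nth_map i) ?size_enum_ord // nth_ord_enum. Qed.

Lemma descentsE m (s : 'S_m) : descents s = count id (word_descents (perm_word s)).
Proof.
have sz : size (word_descents (perm_word s)) = m by rewrite size_pairmap size_perm_word.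
rewrite -sumn_count -[LHS]sum1_card.
rewrite -(pair_big_dep xpredT
  (fun i j : 'I_m => (j == i.+1 :> nat) && (s j < s i)) (fun _ _ => 1)) /=.
rewrite (exchange_big_dep xpredT) //=.
rewrite sumnE big_map (big_nth false) sz big_mkord.
apply: eq_bigr => j _; rewrite (nth_pairmap 0) ?size_perm_word // nth_perm_word.
case: j => [[|j] hj] /=.
  by rewrite big_pred0_eq.
have hi : j < m by apply: ltnW.
rewrite -[nth 0 _ j]/(nth 0 _ (Ordinal hi)) nth_perm_word.
case h: (s (Ordinal hj) < s (Ordinal hi)).
  rewrite (big_pred1 (Ordinal hi)) // => i /=; rewrite eqSS eq_sym.
  rewrite -val_eqE /=; case: eqP => //= e.
  by rewrite (_ : i = Ordinal hi) ?h //; apply: val_inj.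
rewrite big_pred0 // => i; rewrite eqSS; case: eqP => //= e.
by rewrite (_ : i = Ordinal hi) ?h //; apply: val_inj.
Qed.

Lemma perm_word_lift m (p : 'I_m.+1) (s : 'S_m) :
  perm_word (lift_perm p ord_max s) =
  take p (perm_word s) ++ m :: drop p (perm_word s).
Proof.
have pm : p <= m by rewrite -ltnS.
have stk : size (take p (perm_word s)) = p by rewrite size_takel ?size_perm_word.
apply: (@eq_from_nth _ 0).
  by rewrite size_cat /= stk size_drop !size_perm_word addnS subnKC.
move=> i; rewrite size_perm_word => hi.
have -> : i = Ordinal hi :> nat by [].
rewrite nth_perm_word nth_cat stk.
case: (unliftP p (Ordinal hi)) => [k ->|->]; last by rewrite lift_perm_id ltnn subnn.
rewrite lift_perm_lift lift_max /= /bump; case: (leqP p k) => h.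
  by rewrite add1n ltnNge leqW //= subSn //= nth_drop subnKC // nth_perm_word.
by rewrite add0n h nth_take // nth_perm_word.
Qed.

(** A value larger than all letters creates a descent with its right neighbour,
    if any, and destroys the descent that was at the insertion place. *)
Lemma word_descents_insert (w : seq nat) M p : {in w, forall x, x < M} ->
  count id (word_descents (take p w ++ M :: drop p w)) =
  count id (word_descents w) + (p < size w) && ~~ nth false (word_descents w) p.
Proof.
move=> wM; rewrite /word_descents pairmap_cat /= count_cat /=.
have -> : (M < last 0 (take p w)) = false.
  apply/negbTE; rewrite -leqNgt.
  case: (lastP (take p w)) (@mem_take p _ w) => [|u y] // h.
  by rewrite last_rcons ltnW // wM // h // mem_rcons mem_head.
have [sp|ps] := leqP (size w) p.
  by rewrite drop_oversize // take_oversize //= addn0.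
rewrite -{3}[w](cat_take_drop p) pairmap_cat count_cat (drop_nth 0) //=.
rewrite (nth_pairmap 0) // wM ?mem_nth //.
have -> : last 0 (take p w) = nth 0 (0 :: w) p.
  case: (p) ps => [|q] ps /=; first by rewrite take0.
  by rewrite (take_nth 0) ?last_rcons // ltnW.
by case: (_ < _); rewrite /= ?addn0 ?add0n // addn1 addnS.
Qed.

(** Every permutation arises once by inserting the largest value at a position
    of a shorter permutation. *)
Lemma lift_perm_max_bij m :
  bijective (fun q : 'I_m.+1 * 'S_m => lift_perm q.1 ord_max q.2).
Proof.
apply: inj_card_bij; last first.
  by rewrite card_prod !card_Sn card_ord factS.
move=> [p s] [p' s'] /= e.
have pp : p = p'.
  apply: (@perm_inj _ (lift_perm p ord_max s)); rewrite lift_perm_id.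
  by rewrite e lift_perm_id.
subst p'; congr (_, _); apply/permP => i.
have := congr1 (fun t : 'S_m.+1 => t (lift p i)) e.
by rewrite !lift_perm_lift => /lift_inj.
Qed.

Lemma eulerianA_sum m k : eulerianA m k = \sum_(s : 'S_m) (descents s == k).
Proof. by rewrite /eulerianA -sum1_card big_mkcond. Qed.

Lemma descents_le m (s : 'S_m) : descents s <= m.
Proof.
rewrite descentsE -[leqRHS](size_perm_word s).
by rewrite -(size_pairmap (fun x y => y < x) 0) count_size.
Qed.

(** Inserting the largest value at a descent or at the end leaves the number of
    descents unchanged; at the other m - des s places it adds one. *)
Lemma sum_descents_lift m (s : 'S_m) k :
  \sum_(p < m.+1) (descents (lift_perm p ord_max s) == k) =
  (descents s).+1 * (descents s == k) + (m - descents s) * ((descents s).+1 == k).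
Proof.
set B := word_descents (perm_word s).
have sB : size B = m by rewrite size_pairmap size_perm_word.
have E (p : 'I_m.+1) : descents (lift_perm p ord_max s) =
    descents s + (p < m) && ~~ nth false B p.
  rewrite !descentsE perm_word_lift word_descents_insert ?size_perm_word //.
  by move=> x /mapP[i _ ->] /=.
rewrite big_ord_recr /= E ltnn addn0.
under eq_bigr => p _ do rewrite E /= ltn_ord /=.
have dB : \sum_(p < m) (nth false B p : nat) = descents s.
  by rewrite descentsE -sumn_count sumnE big_map (big_nth false) sB big_mkord.
have dB' : \sum_(p < m) (~~ nth false B p : nat) = m - descents s.
  rewrite -dB; apply: (@addIn (\sum_(p < m) (nth false B p : nat))).
  rewrite subnK; last first.
    by rewrite dB descents_le.
  rewrite -big_split /= -[RHS]card_ord -sum1_card; apply: eq_bigr => p _.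
  by case: (nth _ _ _).
rewrite mulSn addnC -addnA; congr (_ + _).
rewrite -dB' -{2}dB !big_distrl -big_split /=; apply: eq_bigr => p _.
by case: (nth _ _ _); rewrite /= ?addn0 ?addn1 ?mul1n ?mul0n ?addn0.
Qed.

Lemma eulerianA_rec m k : eulerianA m.+1 k =
  k.+1 * eulerianA m k + (if k is k'.+1 then (m - k') * eulerianA m k' else 0).
Proof.
rewrite eulerianA_sum (reindex _ (onW_bij _ (lift_perm_max_bij m))) /=.
rewrite -(pair_bigA _ (fun p s => descents (lift_perm p ord_max s) == k : nat)) /=.
rewrite exchange_big /=; under eq_bigr => s _ do rewrite sum_descents_lift.
rewrite big_split /=; congr (_ + _).
  rewrite eulerianA_sum big_distrr /=; apply: eq_bigr => s _.
  by case: eqP => [->|]; rewrite ?muln0.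
case: k => [|k]; first by rewrite big1 // => s _; rewrite muln0.
rewrite eulerianA_sum big_distrr /=; apply: eq_bigr => s _.
by rewrite eqSS; case: eqP => [->|]; rewrite ?muln0.
Qed.

Lemma eulerianA1 k : eulerianA 1 k = (k == 0).
Proof.
rewrite eulerianA_sum (big_pred1 1%g); last first.
  move=> s /=; apply/esym/eqP/permP => i.
  by rewrite (ord1 (s i)) (ord1 ((1%g : 'S_1) i)).
rewrite eq_sym; congr (nat_of_bool (_ == _)).
by apply: eq_card0 => q; case: q => i j; rewrite !inE /= (ord1 i) (ord1 j).
Qed.

End Words.

(** The shift of the first index reflects that the Eulerian polynomial of type A
    of m + 1 letters has degree m. *)
Lemma eulerianAE (R : realFieldType) m k :
  2 ^+ m * (eulerianA m.+1 k)%:R = eulerian_triangle (2 : R) m k.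
Proof.
elim: m k => [|m IH] k; first by rewrite eulerianA1 expr0 mul1r.
rewrite eulerianA_rec natrD mulrDr /= -!IH; congr (_ + _).
  by rewrite natrM exprS -natr1; ring.
case: k => [|k]; first by rewrite mulr0.
rewrite -IH natrM; have [km|mk] := leqP k m.+1.
  by rewrite natrB // exprS -natr1; ring.
have -> : eulerianA m.+1 k = 0%N.
  apply/eqP; rewrite -(eqr_nat R); have := IH k; rewrite eulerian_triangle_gt ?(ltnW mk) //.
  by move/eqP; rewrite mulf_eq0 expf_eq0 pnatr_eq0 andbF.
by rewrite !mulr0.
Qed.

(** * Type B: the generating series *)

Section TypeB.
Variable R : realType.
Implicit Types (x y : R) (N m k : nat).

Definition eulerianB_triangle m : {poly R} := \poly_(k < m.+1) eulerian_triangle 1 m k.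

Lemma coef_eulerianB_triangle m k : (eulerianB_triangle m)`_k = eulerian_triangle 1 m k.
Proof. by rewrite coef_poly; case: ltnP => // mk; rewrite eulerian_triangle_gt. Qed.

Lemma eulerianB_triangleS m : eulerianB_triangle m.+1 =
  (1 + (2 * m%:R + 1)%:P * 'X) * eulerianB_triangle m
  + 2%:P * ((1 - 'X) * ('X * (eulerianB_triangle m)^`())).
Proof.
apply/polyP => k; rewrite coef_eulerianB_triangle mulrDl mul1r mulrBl mul1r -mulrA.
rewrite !(coefD, coefCM, coefN, coefXM, coef_deriv) !coef_eulerianB_triangle /=.
case: k => [|[|k]] /=; rewrite ?coef_deriv ?coef_eulerianB_triangle /=.
- ring.
- ring.
- ring.
Qed.

Definition power_sum m N : {poly R} := \sum_(j < N) ((2 * j + 1)%:R ^+ m) *: 'X^j.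

Lemma power_sumS m N :
  power_sum m.+1 N = power_sum m N + 2%:P * ('X * (power_sum m N)^`()).
Proof.
rewrite /power_sum raddf_sum !mulr_sumr -big_split; apply: eq_bigr => j _ /=.
rewrite derivZ derivXn -!mul_polyC exprS polyCM natrD natrM polyCD polyCM.
case: j => [[|j] hj] /=; first by rewrite mulr0n; ring.
rewrite -mulr_natl exprS [(j.+1%:R)%:P]polyC_natr; ring.
Qed.

(** Differentiating the identity at m gives the one at m + 1, since the power sum
    of exponent m + 1 is the image of the one of exponent m under 1 + 2 X D.  The
    remainder depends polynomially on N, because D X^N = N X^(N - 1): the inner
    variable of [e] stands for N, and [horner_eval] at N is a ring morphism that
    commutes with the derivation in X. *)
Lemma power_sum_remainder m : exists e : {poly {poly R}}, forall N,
  (1 - 'X) ^+ m.+1 * power_sum m N =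
  eulerianB_triangle m + 'X^N * map_poly (horner_eval N%:R) e.
Proof.
elim: m => [|m [e eE]].
  (* the geometric sum: (1 - X) times it is 1 - X^N *)
  exists (- 1) => N; rewrite rmorphN rmorph1 expr1.
  rewrite (_ : eulerianB_triangle 0 = 1); last first.
    by apply/polyP => k; rewrite coef_eulerianB_triangle coef1.
  rewrite mulrN1 /power_sum -[1 - 'X]opprB mulNr.
  rewrite -[RHS]opprB; congr (- _); rewrite subrX1; congr (_ * _).
  by apply: eq_bigr => j _; rewrite expr0 scale1r.
exists ((1 + (2 * m%:R + 1)%:P * 'X)^:P * e
   + (2%:P * (1 - 'X))^:P * ('X%:P * e + 'X * e^`())) => N.
rewrite power_sumS eulerianB_triangleS.
have := congr1 (@deriv R) (eE N); have := eE N.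
set E := map_poly _ e.
have hP (p : {poly R}) : map_poly (horner_eval N%:R) (p^:P) = p.
  rewrite -map_poly_comp map_poly_id // => a _ /=.
  by rewrite horner_evalE hornerC.
have -> (p q : {poly R}) : map_poly (horner_eval N%:R)
    (p^:P * e + q^:P * ('X%:P * e + 'X * e^`())) = p * E + q * (N%:R%:P * E + 'X * E^`()).
  rewrite rmorphD (rmorphM _ p^:P) (rmorphM _ q^:P) /= !hP.
  rewrite rmorphD (rmorphM _ 'X%:P) (rmorphM _ 'X) /=.
  by rewrite map_polyX map_polyC deriv_map /= horner_evalE hornerX.
rewrite derivM derivD derivM deriv_exp derivXn derivB derivX -{1}polyC1 derivC sub0r.
have hN : 'X * ('X^(N.-1) *+ N) = N%:R%:P * 'X^N :> {poly R}.
  by case: (N) => [|M] /=; rewrite ?mulr0n ?mulr0 ?mul0r // polyC_natr mulr_natl mulrnAr exprS.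
move: hN; rewrite -/E [(1 - 'X) ^+ m.+2]exprS [(1 - 'X) ^+ m.+1]exprS /=.
move: ('X^(N.-1) *+ N) 'X^N => Y Z hN.
move: ((1 - 'X) ^+ m) (power_sum m N) (power_sum m N)^`() => d P P'.
move: (eulerianB_triangle m) (eulerianB_triangle m)^`() E^`() => B B' E' h1 h2.
(* the combination (1 - X) h1 + 2 X (1 - X) h2 + 2 (m + 1) X h1, which cancels
   the derivative of the power of 1 - X *)
transitivity ((1 - 'X) * ((1 - 'X) * d * P) + 2%:P * 'X * (1 - 'X) *
   (- 1 * d *+ m.+1 * P + (1 - 'X) * d * P') + 2%:P * (m%:R + 1)%:P * 'X * ((1 - 'X) * d * P)).
  rewrite -mulr_natl -natr1 polyCD polyC_natr polyC1; ring.
rewrite h1 h2; apply/eqP; rewrite -subr_eq0; apply/eqP.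
transitivity (2%:P * (1 - 'X) * E * ('X * Y - N%:R%:P * Z)); last by rewrite hN subrr mulr0.
rewrite !polyCD !polyCM polyC1; ring.
Qed.

(** Since y^N <= y^j for j < N, N y^N is at most a partial sum of the geometric
    series. *)
Lemma mulrn_expr_bound (y : R) N : 0 <= y < 1 -> N%:R * y ^+ N <= (1 - y)^-1.
Proof.
case/andP=> y0 y1; have y1' : 0 < 1 - y by rewrite subr_gt0.
rewrite -[leRHS]mul1r ler_pdivlMr //.
suff : N%:R * y ^+ N * (1 - y) <= 1 - y ^+ N by have := exprn_ge0 N y0; lra.
elim: N => [|N IH]; first by rewrite !mul0r expr0 subrr.
rewrite -natr1 exprS.
have [t0 t1] : 0 <= y ^+ N /\ y ^+ N <= 1 by rewrite exprn_ge0 // exprn_ile1 // ltW.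
move: (y ^+ N) t0 t1 IH => t t0 t1 IH.
have h1 := ler_wpM2l y0 IH.
have h2 : 0 <= (1 - y) * (1 - y * t).
  by rewrite mulr_ge0 ?(ltW y1') // subr_ge0 mulr_ile1 // ltW.
lra.
Qed.

(** With y^2 = |x|, the factor N y^N is bounded and N^k y^N is handled by
    induction. *)
Lemma cvg_natX_expr k x : `|x| < 1 -> (fun N => N%:R ^+ k * x ^+ N) @ \oo --> (0 : R).
Proof.
elim: k x => [|k IH] x x1.
  have := cvg_expr x1; apply: cvg_trans; apply: near_eq_cvg.
  by apply: nearW => N; rewrite expr0 mul1r.
pose y := Num.sqrt `|x|.
have y0 : 0 <= y by apply: sqrtr_ge0.
have yx : y ^+ 2 = `|x| by rewrite sqr_sqrtr.
have y1 : y < 1 by rewrite -(@ltr_pXn2r _ 2) ?nnegrE // yx expr1n.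
have IHy : (fun N => N%:R ^+ k * y ^+ N) @ \oo --> (0 : R) by apply: IH; rewrite ger0_norm.
apply/norm_cvg0P.
have h0 : (fun N => (1 - y)^-1 * (N%:R ^+ k * y ^+ N)) @ \oo --> (0 : R).
  by rewrite -[X in _ --> X](mulr0 ((1 - y)^-1)); apply: cvgM IHy; exact: cvg_cst.
apply: (@squeeze_cvgr _ _ _ _ (cst 0) (fun N => (1 - y)^-1 * (N%:R ^+ k * y ^+ N)));
  last 2 first; [exact: cvg_cst|exact: h0|].
apply: nearW => N /=; rewrite normr_ge0 /= normrM !normrX normr_nat.
rewrite -yx -exprM mul2n -addnn exprD exprS.
have := @mulrn_expr_bound y N; rewrite y0 y1 => /(_ isT) h.
have -> : N%:R * N%:R ^+ k * (y ^+ N * y ^+ N) = (N%:R * y ^+ N) * (N%:R ^+ k * y ^+ N).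
  by rewrite mulrACA.
by rewrite ler_wpM2r // mulr_ge0 // exprn_ge0.
Qed.

Lemma cvg_horner_nat_expr (a : {poly R}) x : `|x| < 1 ->
  (fun N => x ^+ N * a.[N%:R]) @ \oo --> (0 : R).
Proof.
move=> x1.
suff /(_ 0%N) h : forall k, (fun N => N%:R ^+ k * (x ^+ N * a.[N%:R])) @ \oo --> (0 : R).
  apply: cvg_trans h; apply: near_eq_cvg; apply: nearW => N /=.
  by rewrite expr0 mul1r.
elim/poly_ind: a => [|a b IH] k.
  rewrite (_ : (fun N => _) = cst 0); first exact: cvg_cst.
  by apply/funext => N; rewrite horner0 !mulr0.
have -> : (fun N => N%:R ^+ k * (x ^+ N * (a * 'X + b%:P).[N%:R])) =
   (fun N => N%:R ^+ k.+1 * (x ^+ N * a.[N%:R]) + N%:R ^+ k * x ^+ N * b).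
  apply/funext => N; rewrite hornerD hornerM hornerX hornerC exprS; ring.
rewrite -[X in _ --> X](addr0 0) -[X in _ --> _ + X](mul0r b); apply: cvgD; first exact: IH.
by apply: cvgM; [exact: cvg_natX_expr|exact: cvg_cst].
Qed.

Lemma cvg_remainder (e : {poly {poly R}}) x : `|x| < 1 ->
  (fun N => x ^+ N * (map_poly (horner_eval N%:R) e).[x]) @ \oo --> (0 : R).
Proof.
move=> x1; elim/poly_ind: e => [|e a IH].
  rewrite (_ : (fun N => _) = cst 0); first exact: cvg_cst.
  by apply/funext => N; rewrite rmorph0 horner0 mulr0.
have ha := cvg_horner_nat_expr a x1.
have -> : (fun N => x ^+ N * (map_poly (horner_eval N%:R) (e * 'X + a%:P)).[x]) =
   (fun N => x ^+ N * (map_poly (horner_eval N%:R) e).[x] * x + x ^+ N * a.[N%:R]).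
  apply/funext => N; rewrite rmorphD rmorphM /= map_polyX map_polyC /=.
  by rewrite hornerD hornerM hornerX hornerC horner_evalE; ring.
rewrite -[X in _ --> X](addr0 0) -[X in _ --> X + _](mul0r x).
by apply: cvgD ha; apply: cvgM IH _; exact: cvg_cst.
Qed.

Lemma norm_lt1_subr_neq0 x : `|x| < 1 -> 1 - x != 0.
Proof.
by rewrite subr_eq0 eq_sym => x1; apply: contraTneq x1 => ->; rewrite normr1 ltxx.
Qed.

Lemma is_eulerianB_polyP m : is_eulerianB_poly m (eulerianB_triangle m).
Proof.
split; first exact: size_poly.
move=> x x1; have [e eE] := power_sum_remainder m.
have x0 := norm_lt1_subr_neq0 x1.
have -> : series (fun j : nat => (2 * j + 1)%:R ^+ m * x ^+ j) =
  (fun N => (eulerianB_triangle m).[x] / (1 - x) ^+ m.+1 +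
     x ^+ N * (map_poly (horner_eval N%:R) e).[x] / (1 - x) ^+ m.+1).
  apply/funext => N; rewrite -mulrDl; apply: (mulIf (expf_neq0 m.+1 x0)).
  rewrite divfK ?expf_neq0 //; have /(congr1 (horner^~ x)) := eE N.
  rewrite hornerD !hornerM hornerXn horner_exp hornerD hornerN hornerX hornerC => <-.
  rewrite mulrC; congr (_ * _); rewrite /series /= big_mkord horner_sum.
  by apply: eq_bigr => j _; rewrite hornerZ hornerXn.
rewrite -[X in _ --> X]addr0 -[X in _ --> _ + X](mul0r ((1 - x) ^+ m.+1)^-1).
apply: cvgD; first exact: cvg_cst.
by apply: cvgM; [exact: cvg_remainder|exact: cvg_cst].
Qed.

(** The values on ]-1, 1[ determine a polynomial; the points 1 / (j + 2) suffice. *)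
Lemma is_eulerianB_poly_unique m : is_subset1 [set p : {poly R} | is_eulerianB_poly m p].
Proof.
move=> p q [_ hp] [_ hq]; apply/eqP; rewrite -subr_eq0; apply/eqP.
pose rs : seq R := [seq (j.+2%:R)^-1 | j <- iota 0 (size (p - q))].
apply: (@roots_geq_poly_eq0 _ _ rs); last by rewrite size_map size_iota.
  apply/allP => _ /mapP[j _ ->]; set x := _^-1.
  have x1 : `|x| < 1 by rewrite ger0_norm ?invr_ge0 // invf_lt1 // ltr1n.
  have x0 := norm_lt1_subr_neq0 x1.
  have e : p.[x] = q.[x].
    apply: (mulIf (invr_neq0 (expf_neq0 m.+1 x0))).
    by apply: (cvg_unique _ (hp x x1) (hq x x1)); exact: norm_hausdorff.
  by rewrite /root hornerD hornerN e subrr.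
rewrite map_inj_uniq ?iota_uniq // => i j /invr_inj /eqP; rewrite eqr_nat => /eqP [].
by [].
Qed.

Lemma eulerianBE m k : eulerianB R m k = eulerian_triangle 1 m k.
Proof.
rewrite /eulerianB /eulerianB_poly (@xget_subset1 _ _ _ (eulerianB_triangle m)).
- by rewrite coef_eulerianB_triangle.
- exact: is_eulerianB_polyP.
- exact: is_eulerianB_poly_unique.
Qed.
End TypeB.

(** * Even polynomials and the theorem *)

Section EvenPolynomials.
Variable R : realType.
Implicit Types (s w : seq R) (k x : R).

Definition sqrt_roots s : seq R := map Num.sqrt s ++ map (fun x => - Num.sqrt x) s.

Lemma root_prod_comp_sqr s : {in s, forall x, 0 < x < 1} ->
  root_prod s \Po 'X^2 = root_prod (sqrt_roots s).
Proof.
move=> s01; rewrite big_cat /= !big_map -big_split /= rmorph_prod.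
apply: eq_big_seq => x /s01/andP[x0 _] /=.
rewrite comp_polyB comp_polyX comp_polyC -{1}(sqr_sqrtr (ltW x0)) polyCN opprK.
by rewrite rmorphXn -subr_sqr.
Qed.

Lemma uniq_sqrt_roots s : uniq s -> {in s, forall x, 0 < x < 1} ->
  uniq (sqrt_roots s).
Proof.
move=> us s01.
have si : {in s &, injective Num.sqrt}.
  move=> x y /s01/andP[x0 _] /s01/andP[y0 _] e.
  by rewrite -(sqr_sqrtr (ltW x0)) e sqr_sqrtr // ltW.
rewrite cat_uniq !map_inj_in_uniq ?us ?andbT //; last first.
  by move=> x y xs ys /oppr_inj; apply: si.
apply/hasPn => _ /mapP[x /s01/andP[x0 _] ->]; apply/mapP => -[y /s01/andP[y0 _]].
move=> e; have := sqrtr_ge0 y; rewrite -e oppr_ge0 leNgt sqrtr_gt0 x0 //.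
Qed.

Lemma sqrt_roots_bounds s : {in s, forall x, 0 < x < 1} ->
  {in sqrt_roots s, forall x, -1 < x < 1 /\ x != 0}.
Proof.
move=> s01 x; rewrite mem_cat => /orP[] /mapP[y /s01/andP[y0 y1] ->].
  have := sqrtr_gt0 y; rewrite y0 => h; have : Num.sqrt y < 1 by rewrite -[1]sqrtr1 ltr_sqrt.
  by move=> h1; rewrite gt_eqF // h1 (lt_trans _ h) // ltrN10.
have := sqrtr_gt0 y; rewrite y0 => h; have : Num.sqrt y < 1 by rewrite -[1]sqrtr1 ltr_sqrt.
by move=> h1; rewrite oppr_eq0 gt_eqF // ltrN2 h1 (lt_trans _ (@ltr01 R)) // oppr_lt0.
Qed.

Lemma zeros_real_simple_prod k w : k != 0 -> uniq w ->
  {in w, forall x, -1 < x < 1 /\ x != 0} -> zeros_real_simple (k *: root_prod w).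
Proof.
move=> k0 uw wP pC z; rewrite {}/pC map_polyZ.
have -> : map_poly (real_complex R) (root_prod w) = root_prod (map (real_complex R) w).
  rewrite rmorph_prod big_map; apply: eq_bigr => x _.
  by rewrite rmorphB /= map_polyX map_polyC.
have c0 : real_complex R k != 0 by rewrite fmorph_eq0.
rewrite rootZ // root_prod_XsubC => /mapP[x xw zx].
have uC : uniq (map (real_complex R) w) by rewrite map_inj_uniq //; apply: fmorph_inj.
split; last by exists x; have [] := wP x xw.
rewrite -mul_polyC mupMr ?rootC // mu_prod_XsubC count_uniq_mem //.
by rewrite zx map_f.
Qed.

Lemma root_comp_sqr s x : {in s, forall x, 0 < x < 1} ->
  root (root_prod s \Po 'X^2) x = (`|x| \in map Num.sqrt s).
Proof.
move=> s01; rewrite /root horner_comp hornerXn -/(root _ _) root_prod_XsubC.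
apply/idP/mapP => [xs|[y ys xy]]; first by exists (x ^+ 2); rewrite ?sqrtr_sqr.
by rewrite -real_normK ?num_real // xy sqr_sqrtr //; case/andP: (s01 y ys) => /ltW.
Qed.

Lemma sech_poly_zeros_real_simple c k m : 0 < c -> k != 0 ->
  zeros_real_simple (k *: (sech_poly c m \Po 'X^2)).
Proof.
move=> c0 k0; have [s [us s01 _ ->]] := sech_poly_split m c0.
have [_ l] := size_sech_poly m c0.
rewrite comp_polyZ scalerA root_prod_comp_sqr //.
apply: zeros_real_simple_prod; first by rewrite mulf_neq0 // gt_eqF.
  exact: uniq_sqrt_roots.
exact: sqrt_roots_bounds.
Qed.

Lemma sech_poly_sorted_split c m : 0 < c -> exists s,
  [/\ sorted <%R s, {in s, forall x, 0 < x < 1}, size s = m./2 &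
     sech_poly c m = lead_coef (sech_poly c m) *: root_prod s].
Proof.
move=> c0; have [s [us s01 ss sE]] := sech_poly_split m c0.
exists (sort <=%R s); split.
- by rewrite sort_lt_sorted.
- by move=> x; rewrite mem_sort; apply: s01.
- by rewrite size_sort.
- by rewrite {1}sE; congr (_ *: _); apply: perm_big; rewrite perm_sym perm_sort.
Qed.

Lemma sech_poly_zeros_interlace c k k' m : 0 < c -> k != 0 -> k' != 0 ->
  zeros_interlace (k *: (sech_poly c m \Po 'X^2)) (k' *: (sech_poly c m.+2 \Po 'X^2)).
Proof.
move=> c0 k0 k0'.
have [a [sa a01 za aE]] := sech_poly_sorted_split m c0.
have [b [sb b01 zb bE]] := sech_poly_sorted_split m.+2 c0.
have [_ la] := size_sech_poly m c0; have [_ lb] := size_sech_poly m.+2 c0.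
have zab : size b = (size a).+1 by rewrite zb za.
have sg : {in a, forall x, (root_prod b).[x] * (root_prod a)^`().[x] < 0}.
  move=> x xa; have : root (sech_poly c m) x by rewrite aE rootZ ?gt_eqF // root_prod_XsubC.
  move/(sech_poly_step2_sign c0); rewrite aE bE derivZ !hornerZ mulrACA.
  by rewrite pmulr_rlt0 // mulr_gt0.
exists (map Num.sqrt a), (map Num.sqrt b); split.
- by move=> x; rewrite aE comp_polyZ rootZ // rootZ ?gt_eqF // root_comp_sqr.
- by move=> x; rewrite bE comp_polyZ rootZ // rootZ ?gt_eqF // root_comp_sqr.
- by rewrite !size_map.
- rewrite (nth_map 0) ?zab // sqrtr_gt0.
  by have /b01/andP[] : b`_0 \in b by rewrite mem_nth ?zab.
move=> i; rewrite size_map => ia.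
have /andP[h1 h2] := interlace_of_signs sa sb zab sg ia.
have a0 : 0 < a`_i by have /a01/andP[] := mem_nth 0 ia.
have b0 : 0 < b`_i.+1 by apply: lt_trans a0 h2.
rewrite !(nth_map 0) ?zab ?ltnS //; last exact: ltnW.
by rewrite !ltr_sqrt // h1 h2.
Qed.

End EvenPolynomials.

Section Reduction.
Variable R : realType.

Lemma eulerian_sum_sech_poly (c a : R) (E : nat -> R) n : 0 < c -> a != 0 -> (0 < n)%N ->
  (forall k, (k < n)%N -> a * E k = eulerian_triangle c (2 * n - 1) k) ->
  \sum_(t < n) eulerian_coef E n t *: 'X^(2 * t) =
    (a^-1 * 2 ^+ (2 * n - 2)) *: (sech_poly c (2 * n - 1) \Po 'X^2).
Proof.
move=> c0 a0 n0 aE; rewrite comp_sech_poly_sum // scaler_sumr; apply: eq_bigr => t _.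
by rewrite scalerA -mulrA -(eulerian_coefE t n0 aE) mulKf.
Qed.

Lemma XiE n : (0 < n)%N ->
  exists2 k : R, k != 0 & Xi R n = k *: (sech_poly 1 (2 * n - 1) \Po 'X^2).
Proof.
move=> n0; rewrite /Xi /eulerian_coefB.
have -> : \sum_(t < n) eulerian_coef (eulerianB R (2 * n - 1)) n t *: 'X^(2 * t) =
    (1^-1 * 2 ^+ (2 * n - 2)) *: (sech_poly (1 : R) (2 * n - 1) \Po 'X^2).
  apply: eulerian_sum_sech_poly => // k _; by rewrite mul1r eulerianBE.
rewrite scalerA; eexists; last by [].
rewrite !mulf_neq0 ?invr_neq0 ?mulf_neq0 ?expf_neq0 ?oppr_eq0 ?oner_neq0 ?pnatr_eq0 //.
by rewrite -lt0n fact_gt0.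
Qed.

Lemma LambdaE n : (0 < n)%N ->
  exists2 k : R, k != 0 & Lambda R n = k *: (sech_poly 2 (2 * n - 1) \Po 'X^2).
Proof.
move=> n0; rewrite /Lambda /eulerian_coefA.
have two0 : (2 : R) != 0 by rewrite pnatr_eq0.
have -> : \sum_(t < n) eulerian_coef (fun k => (eulerianA (2 * n) k)%:R) n t *: 'X^(2 * t) =
    ((2 ^+ (2 * n - 1))^-1 * 2 ^+ (2 * n - 2)) *: (sech_poly (2 : R) (2 * n - 1) \Po 'X^2).
  apply: eulerian_sum_sech_poly; rewrite ?expf_neq0 //.
  move=> k _; rewrite -eulerianAE (_ : (2 * n - 1).+1 = 2 * n)%N //; lia.
rewrite scalerA; eexists; last by [].
have p0 : (2 : R) ^+ (2 * n + 1) - 1 != 0.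
  by rewrite subr_eq0 gt_eqF // exprn_egt1 ?ltr1n // addn1.
rewrite !mulf_neq0 ?invr_neq0 ?mulf_neq0 ?expf_neq0 ?oppr_eq0 ?oner_neq0 ?pnatr_eq0 //.
by rewrite -lt0n fact_gt0.
Qed.

End Reduction.

Theorem theorem9p1 (R : realType) (n : nat) (hn : (2 <= n)%N) :
  [/\ zeros_real_simple (Lambda R n),
      zeros_real_simple (Xi R n),
      zeros_interlace (Lambda R n) (Lambda R n.+1)
    & zeros_interlace (Xi R n) (Xi R n.+1)].
Proof.
have n0 : (0 < n)%N by apply: ltnW.
have e : (2 * n.+1 - 1 = (2 * n - 1).+2)%N by lia.
have [k k0 ->] := LambdaE R n0; have [k' k0' ->] := LambdaE R (ltn0Sn n).
have [l l0 ->] := XiE R n0; have [l' l0' ->] := XiE R (ltn0Sn n).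
rewrite e; split.
- exact: sech_poly_zeros_real_simple.
- exact: sech_poly_zeros_real_simple.
- exact: sech_poly_zeros_interlace.
- exact: sech_poly_zeros_interlace.
Qed.
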